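(* The set $$X_\infty=\Big\{x\in\mathbb T:\liminf_{n\to\infty}\frac1n\sum_{i=1}^n\log_2 d(T^ix,x)=-\infty\Big\}$$ has Hausdorff dimension zero.
   Context: $\mathbb T=\mathbb R/\mathbb Z$, $Tx=2x\bmod1$, $d(t,s)=\|t-s\|$ with $\|x\|=\inf_{n\in\mathbb Z}|x-n|$; convention $\log_2 0=-\infty$. *)

(* Defs.v *)
From HB Require Import structures.
From mathcomp Require Import all_boot all_order all_algebra.
From mathcomp Require Import all_classical all_reals all_analysis.
Set Implicit Arguments. Unset Strict Implicit. Unset Printing Implicit Defensive.
Import Order.TTheory GRing.Theory Num.Theory.
Import numFieldNormedType.Exports.
Local Open Scope classical_set_scope.
Local Open Scope ring_scope.

Section Torus.
Variable R : realType.

(* The circle T = R/Z, represented by its fundamental domain [0,1). *)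
Definition torus : set R := [set x | 0 <= x < 1].

Definition tnorm (x : R) : R := inf [set `|x - n%:~R| | n in [set: int]].

Definition tdist (t s : R) : R := tnorm (t - s).

Definition doubling (x : R) : R := 2 * x - (Num.floor (2 * x))%:~R.

Definition log2e (y : R) : \bar R :=
  if y == 0 then -oo%E else (ln y / ln 2)%:E.

(* Birkhoff-type averages (1/n) sum_{i=1}^n log_2 d(T^i x, x), indexed from n = 1
   (the term at index k is the average with n = k.+1) *)
Definition avg_log_return (x : R) (k : nat) : \bar R :=
  ((k.+1%:R)^-1)%:E * (\sum_(1 <= i < k.+2) log2e (tdist (iter i doubling x) x))%E.

Definition X_infty : set R :=
  [set x | torus x /\ limn_einf (avg_log_return x) = -oo%E].

(* Diameter w.r.t. d (diam of the empty set is 0) *)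
Definition tdiam (U : set R) : R := sup [set tdist u v | u in U & v in U].

Definition diam_pow (s : R) (U : set R) : R :=
  if U == set0 then 0 else powR (tdiam U) s.

Definition hausdorff_delta (s delta : R) (A : set R) : \bar R :=
  ereal_inf [set (\sum_(0 <= i <oo) (diam_pow s (U i))%:E)%E
            | U in [set U : nat -> set R |
                    (forall i, U i `<=` torus) /\ A `<=` \bigcup_i U i /\
                    (forall i, tdiam (U i) <= delta)]].

(* s-dimensional Hausdorff measure: limit as delta -> 0+ (a supremum, by monotonicity) *)
Definition hausdorff_measure (s : R) (A : set R) : \bar R :=
  ereal_sup [set hausdorff_delta s delta A | delta in [set delta : R | 0 < delta]].

Definition hausdorff_dim (A : set R) : \bar R :=
  ereal_inf [set s%:E | s in [set s : R | 0 <= s /\ hausdorff_measure s A = 0%E]].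

End Torus.

(* Main.v *)
(* Write delta_i = ||(2^i - 1) x|| = d(T^i x, x) ~ 2^(- a_i): a_i is the length over which the
   binary expansion of x at position i copies its own prefix. Parse the expansion into literals
   and copies of prefixes of length at least B. Points that, at infinitely many scales N, admit a
   parse with fewer than N / H literals form a limsup set of small dimension: at scale N the parse,
   the literals and O(1) choices per copy determine the dyadic cell, so 2^(N / H) rho^N cells of
   size 2^(- N) suffice, with rho close to 1 when B is large.
   For every other x the copies are short, a_i <= C i; hence two occurrences p, p + d of the prefix
   of length k are at distance d >= k / D. Parse greedily into copied blocks. Within a block the
   sum of the a_i is at most the sum over the corresponding prefix plus O(block length), and the
   blocks leave out a fixed proportion of literals, so the sum of a_i over i < L is at most f L by
   induction on L, and the averages of log_2 delta_i are bounded below. *)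
Require Import Defs.
From HB Require Import structures.
From mathcomp Require Import all_boot all_order all_algebra.
From mathcomp Require Import all_classical all_reals all_analysis.
From mathcomp Require Import zify lra ring.
Set Implicit Arguments. Unset Strict Implicit. Unset Printing Implicit Defensive.
Import Order.TTheory GRing.Theory Num.Theory.
Import numFieldNormedType.Exports.

(** * Sums of copy lengths *)

(* [lz_parse copy p q l]: the positions p .. q - 1 are split into l single literals and blocks
   of length b, a block starting at p being allowed when [copy p b]. *)
Inductive lz_parse (copy : nat -> nat -> Prop) : nat -> nat -> nat -> Prop :=
| LzNil p : lz_parse copy p p 0
| LzLit p q l : lz_parse copy p.+1 q l -> lz_parse copy p q l.+1
| LzCopy p b q l : copy p b -> lz_parse copy (p + b) q l -> lz_parse copy p q l.

Lemma lz_parse_trans copy p q r l m :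
  lz_parse copy p q l -> lz_parse copy q r m -> lz_parse copy p r (l + m).
Proof.
move=> pq qr; elim: pq qr => {p q l} [p|p q l _ IH|p b q l cb _ IH] qr //.
  by rewrite addSn; apply/LzLit/IH.
exact/(LzCopy cb)/IH.
Qed.

Lemma lz_parse_lits copy p n : lz_parse copy p (p + n) n.
Proof.
elim: n p => [|n IH] p; first by rewrite addn0; exact: LzNil.
by apply: LzLit; rewrite -addSnnS.
Qed.

Lemma sub_lz_parse (copy copy' : nat -> nat -> Prop) p q l :
  (forall p b, copy p b -> copy' p b) -> lz_parse copy p q l -> lz_parse copy' p q l.
Proof.
move=> sub; elim=> {p q l} [p|p q l _|p b q l cb _]; first exact: LzNil.
  exact: LzLit.
exact/LzCopy/sub.
Qed.

Lemma lz_parse_le copy p q l : lz_parse copy p q l -> (p <= q)%N.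
Proof. by elim=> {p q l} [//|p q l _ /ltnW//|p b q l _ _]; apply: leq_trans; rewrite leq_addr. Qed.

Lemma lz_parse_inv copy p q l : lz_parse copy p q l ->
  [\/ p = q, exists2 l', l = l'.+1 & lz_parse copy p.+1 q l' |
     exists2 b, copy p b & lz_parse copy (p + b) q l].
Proof.
by case=> {p q l} [p|p q l h|p b q l cb h]; [constructor 1|constructor 2; exists l|constructor 3; exists b].
Qed.

(** Pigeonhole: separation makes i |-> floor(D i / k) injective on P, and on i <= A <= 2 k its
    values are at most 2 D. *)
Lemma card_separated (P : pred nat) (A D k : nat) : 0 < k -> A <= 2 * k ->
  (forall d e, P d -> P e -> d < e -> k <= D * (e - d)) ->
  #|[pred i : 'I_A.+1 | P i]| <= (2 * D).+1.
Proof.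
move=> k0 Ak sep.
have bnd (i : 'I_A.+1) : (D * i) %/ k < (2 * D).+1.
  rewrite ltnS; apply: leq_trans (leq_div2r k (_ : _ <= 2 * D * k)) _.
    by rewrite -mulnA mulnCA leq_mul2l; apply/orP; right; have := ltn_ord i; lia.
  by rewrite mulnK.
pose g (i : 'I_A.+1) : 'I_(2 * D).+1 := Ordinal (bnd i).
rewrite -[X in _ <= X]card_ord; apply: (@leq_card_in _ _ g) => i j Pi Pj [] E.
apply: val_inj => /=; move: Pi Pj; rewrite !inE => Pi Pj.
have aux (d e : nat) : P d -> P e -> (D * d) %/ k = (D * e) %/ k -> ~ d < e.
  move=> Pd Pe Ede lde; have := sep _ _ Pd Pe lde.
  rewrite mulnBr; have := divn_eq (D * d) k; have := divn_eq (D * e) k.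
  have := ltn_pmod (D * e) k0; rewrite Ede.
  have := leq_mul (leqnn D) (ltnW lde); lia.
have := aux _ _ Pi Pj E; have := aux _ _ Pj Pi (esym E); lia.
Qed.

(* Halving A: the values in [A / 2, A) sit at mutual distance at least A / (2 * D), so there are
   at most 2 * D + 1 of them, and the smaller values live on [1, A / 2] only. *)
Lemma sum_crossing (v : nat -> nat) (D A : nat) :
  (forall d e, 0 < d -> d < e -> minn (v d) (v e) <= D * (e - d)) ->
  \sum_(1 <= e < A.+1 | (e <= (v e).+1) && (v e < A)) v e <= (8 * D + 4) * A.
Proof.
move=> sep; elim/ltn_ind: A => A IH.
case: (leqP A 1) => [A1|A1]; first by rewrite big1 // => e; lia.
pose k := uphalf A.
have kA : k < A /\ A <= 2 * k /\ 2 * k <= A.+1 /\ 0 < k by rewrite /k; lia.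
rewrite (bigID (fun e => v e < k)) /=.
have low : \sum_(1 <= e < A.+1 | (e <= (v e).+1) && (v e < A) && (v e < k)) v e <=
    (8 * D + 4) * k.
  apply: leq_trans (IH k _); last by lia.
  (* Since e <= v e + 1 and v e < k force e <= k, the range beyond k is empty. *)
  rewrite (@big_cat_nat _ _ _ k.+1 1 A.+1) /=; [|lia|lia].
  rewrite [X in _ + X]big_nat_cond [X in _ + X]big_pred0 ?addn0; last by move=> e; apply/negbTE; lia.
  by rewrite leq_eqVlt; apply/orP; left; apply/eqP; apply: eq_bigl => e; apply/idP/idP; lia.
have high : \sum_(1 <= e < A.+1 | (e <= (v e).+1) && (v e < A) && ~~ (v e < k)) v e <=
    (2 * D).+1 * A.
  pose P := [pred e | [&& 0 < e, (v e < A) & (k <= v e)]].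
  apply: leq_trans (_ : \sum_(i < A.+1 | P i) A <= _).
    rewrite -(big_mkord P (fun=> A)) [X in _ <= X]big_ltn_cond ?if_same; last by lia.
    rewrite big_nat_cond [X in _ <= X]big_nat_cond /P /=.
    rewrite big_mkcond [X in _ <= X]big_mkcond /=; apply: leq_sum => e _.
    by do 2![case: ifP => //]; lia.
  rewrite sum_nat_const leq_mul2r; apply/orP; right.
  apply: (@card_separated P A D k); [lia|lia|].
  move=> d e /and3P[d0 _ vd] /and3P[e0 _ ve] de.
  by have := sep _ _ d0 de; lia.
apply: leq_trans (leq_add low high) _.
(* As 2 k <= A + 1, the total is at most (6 D + 3) A + 4 D + 2, and A >= 2 absorbs the constant. *)
have ->: (8 * D + 4) * k = (4 * D + 2) * (2 * k) by lia.
apply: leq_trans (leq_add (leq_mul (leqnn _) (_ : _ <= A.+1)) (leqnn _)) _; first by lia.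
by have := leq_mul (leqnn (2 * D + 1)) A1; lia.
Qed.

(* Inside a block copied from the prefix, a position either repeats the corresponding position of
   the prefix or its own copy overruns the block; [sum_crossing] bounds the latter. *)
Lemma segment_sum (a : nat -> nat) (D p t : nat) :
  (forall p d, 0 < p -> 0 < d -> minn (a p) (a (p + d)) <= D * d) ->
  (forall p d, 0 < p -> 0 < d -> a (p + d) <= (a d).+1 \/ a p <= a (p + d) + d.+1) ->
  0 < p -> 0 < t -> t <= a p ->
  (forall d, 0 < d -> d < t -> a (p + d) < a p) ->
  \sum_(p <= i < p + t) a i <= (8 * D + 5) * a p + t + \sum_(1 <= i < t) a i.
Proof.
move=> sep copy p0 t0 ta small.
rewrite big_ltn; last by lia.
rewrite -[p.+1]add1n big_addn addKn.
under eq_bigr do rewrite addnC.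
(* Counting e from the end of the copied range: at offset d = a p - e the overrun condition a p <= a
   (p + d) + d + 1 reads e <= v e + 1, as in [sum_crossing]. *)
pose v e := a (p + (a p - e)).
have cross : \sum_(1 <= d < t | a p <= a (p + d) + d.+1) a (p + d) <= (8 * D + 4) * a p.
  (* For e >= a p truncated subtraction freezes v e at a p, which could break separation; hence the
     cutoff. *)
  pose w e := if e < a p then v e else 0.
  apply: leq_trans (@sum_crossing w D (a p) _); last first.
    move=> d e d0 de; rewrite /w; case: ifP => d1; case: ifP => e1 //; rewrite ?minn0 ?min0n //.
    have := sep (p + (a p - e)) (e - d); rewrite /v minnC.
    have -> : p + (a p - e) + (e - d) = p + (a p - d) by lia.
    by apply; lia.
  apply: leq_trans (_ : \sum_(1 <= d < a p | (a p <= a (p + d) + d.+1) && (a (p + d) < a p)) a (p + d) <= _).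
    rewrite [X in _ <= X](@big_cat_nat _ _ _ t) //=; apply: leq_trans (leq_addr _ _).
    rewrite big_nat_cond [X in _ <= X]big_nat_cond leq_eqVlt; apply/orP; left; apply/eqP.
    apply: eq_bigl => d; have := small d; case: (0 < d); case: (d < t) => //= -> //.
    by rewrite !andbT.
  rewrite big_nat_rev /=.
  rewrite [X in _ <= X](@big_cat_nat _ _ _ (a p)) //=; last by lia.
  apply: leq_trans (leq_addr _ _).
  rewrite big_nat_cond [X in _ <= X]big_nat_cond.
  rewrite big_mkcond [X in _ <= X]big_mkcond /=; apply: leq_sum => e _.
  rewrite /w /v (_ : 1 + a p - e.+1 = a p - e) //; case: ifP => // /andP[/andP[e0 eA] /andP[H1 H2]].
  by rewrite eA; case: ifP => //; lia.
rewrite (bigID (fun d => a p <= a (p + d) + d.+1)) /=.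
have rest : \sum_(1 <= d < t | ~~ (a p <= a (p + d) + d.+1)) a (p + d) <=
    t + \sum_(1 <= d < t) a d.
  apply: leq_trans (_ : \sum_(1 <= d < t) (1 + a d) <= _); last first.
    by rewrite big_split /= sum_nat_const_nat; lia.
  rewrite big_nat_cond [X in _ <= X]big_nat_cond.
  rewrite big_mkcond [X in _ <= X]big_mkcond /=; apply: leq_sum => d _.
  case: ifP => // /andP[/andP[d0 dt] H]; rewrite d0 dt /=.
  by case: (copy p d p0 d0) => H'; lia.
by have := leq_add cross rest; lia.
Qed.

(* The block starting at p is cut at the first later q with [a p <= a q]; separation of p and q
   then still forces its length to be at least [a p / D]. *)
Lemma greedy_parse (a : nat -> nat) (B D f L : nat) : 0 < B -> 0 < D ->
  (forall p d, 0 < p -> 0 < d -> minn (a p) (a (p + d)) <= D * d) ->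
  (forall p d, 0 < p -> 0 < d -> a (p + d) <= (a d).+1 \/ a p <= a (p + d) + d.+1) ->
  (forall b, b < L -> \sum_(1 <= i < b) a i <= f * b) -> 0 < L ->
  exists p l, [/\ 0 < p <= L, l < p, lz_parse (fun p b => B <= b <= a p) 1 p l,
    \sum_(1 <= i < p) a i <= B * D * l + ((8 * D + 5) * D + 1 + f) * (p - l.+1) &
    p = L \/ [/\ p < L, L < p + a p & forall d, 0 < d -> d < L - p -> a (p + d) < a p]].
Proof.
move=> B0 D0 sep copy IHf L0; set kappa := (8 * D + 5) * D + 1.
(* Invariant of the greedy parse: each of the l literals is charged B D, and each of the p - l - 1
   positions inside blocks is charged kappa + f. *)
suff main m p l : L - p <= m -> 0 < p <= L -> l < p ->
    lz_parse (fun p b => B <= b <= a p) 1 p l ->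
    \sum_(1 <= i < p) a i <= B * D * l + (kappa + f) * (p - l.+1) ->
    exists p l, [/\ 0 < p <= L, l < p, lz_parse (fun p b => B <= b <= a p) 1 p l,
    \sum_(1 <= i < p) a i <= B * D * l + (kappa + f) * (p - l.+1) &
    p = L \/ [/\ p < L, L < p + a p & forall d, 0 < d -> d < L - p -> a (p + d) < a p]].
  apply: (main (L - 1) 1 0) => //; first exact: LzNil.
  by rewrite big_geq.
elim: m p l => [|m IH] p l Lm /andP[p0 pL] lp par G.
  by exists p, l; split=> //; [rewrite p0|left; lia].
have [pL'|ltpL] := eqVneq p L; first by exists p, l; split=> //; [rewrite p0|left].
(* A value below B D is paid for by a literal; a larger one yields a cut block of length at least B,
   hence an admissible one. *)
case: (ltnP (a p) (B * D)) => [small|large].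
  apply: (IH p.+1 l.+1); [lia|lia|lia| |].
    by rewrite -[l.+1]addn1; apply: lz_parse_trans par _; exact/LzLit/LzNil.
  by rewrite big_nat_recr //= subSS mulnSr; lia.
have ap0 : 0 < a p by apply: leq_trans large; rewrite muln_gt0 B0.
have ex : exists q, (p < q) && ((q == p + a p) || (a p <= a q)).
  by exists (p + a p); rewrite eqxx; lia.
case: (ex_minnP ex) => q /andP[pq Pq] qmin.
have qle : q <= p + a p by apply: qmin; rewrite eqxx; lia.
have before d : 0 < d -> d < q - p -> a (p + d) < a p.
  move=> d0 dq; rewrite ltnNge; apply/negP => H.
  have : q <= p + d by apply: qmin; rewrite H orbT; lia.
  lia.
have apD : a p <= D * (q - p).
  case/orP: Pq => [/eqP ->|le]; first by rewrite addKn leq_pmull.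
  have := sep p (q - p) p0; rewrite subnKC ?(ltnW pq) //.
  by rewrite (minn_idPl le); apply; lia.
case: (leqP q L) => qL; last first.
  exists p, l; split=> //; first by rewrite p0.
  right; split; [by lia|by lia|] => d d0 dL; apply: before => //; lia.
have Bb : B <= q - p.
  by rewrite -(leq_pmul2l D0); apply: leq_trans apD; rewrite mulnC.
apply: (IH q l); [lia|lia|lia| |].
  rewrite -[l]addn0; apply: lz_parse_trans par _.
  apply: (@LzCopy _ p (q - p)); first by rewrite Bb; lia.
  by rewrite subnKC ?(ltnW pq) //; exact: LzNil.
have seg : \sum_(p <= i < q) a i <= (8 * D + 5) * a p + (q - p) + \sum_(1 <= i < q - p) a i.
  rewrite -[X in \sum_(_ <= _ < X) a _](subnKC (ltnW pq)).
  by apply: (@segment_sum a D) => //; lia.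
rewrite (@big_cat_nat _ _ _ p) //=; last exact: ltnW.
have bL : q - p < L by lia.
have := IHf _ bL => Gb.
have -> : q - l.+1 = (p - l.+1) + (q - p) by lia.
have apD' := leq_mul (leqnn (8 * D + 5)) apD.
have -> : kappa + f = (8 * D + 5) * D + (1 + f) by rewrite /kappa; lia.
move: G; have -> : kappa + f = (8 * D + 5) * D + (1 + f) by rewrite /kappa; lia.
move: apD' Gb seg; rewrite mulnA mulnDr; rewrite (mulnDl _ (1 + f) (q - p)) (mulnDl 1 f (q - p)) mul1n.
lia.
Qed.

(** Strong induction on L. The positions inside blocks inherit the factor f from shorter prefixes,
    but literals do not: this saves f (l + 1). Incompressibility makes l + 1 proportional to L, so
    the saving pays for all remaining costs. *)
Lemma linear_sum_of_incompressible (a : nat -> nat) (B C D H N0 : nat) :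
  0 < B -> 0 < D ->
  (forall p, 0 < p -> a p <= C * p) ->
  (forall p d, 0 < p -> 0 < d -> minn (a p) (a (p + d)) <= D * d) ->
  (forall p d, 0 < p -> 0 < d -> a (p + d) <= (a d).+1 \/ a p <= a (p + d) + d.+1) ->
  (forall N l, N0 <= N -> lz_parse (fun p b => B <= b <= a p) 1 N l -> N <= H * l) ->
  exists f, forall L, \sum_(1 <= i < L) a i <= f * L.
Proof.
move=> B0 D0 lin sep copy incompr.
(* The summands of kappa pay for literals, for complete blocks and for the last block, which may
   overrun L. The factor (C + 1) (H + N0) in f gives kappa L <= f (l + 1), with N0 covering the case
   p < N0. *)
pose kappa := B * D + ((8 * D + 5) * D + 1) + (8 * D + 5) * C + 1.
exists (kappa * ((C + 1) * (H + N0))); set f := kappa * _.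
elim/ltn_ind => L IH; have [->|L0] := posnP L; first by rewrite big_geq.
have [p [l [/andP[p0 pL] lp par G fin]]] := greedy_parse B0 D0 sep copy IH L0.
have pl : p <= (H + N0) * l.+1.
  case: (leqP N0 p) => [N0p|pN0]; last by rewrite mulnS mulnDl; lia.
  have := incompr _ _ N0p par; rewrite mulnS mulnDl; lia.
have Lp : L <= (C + 1) * p by case: fin => [->|[_ ? _]]; have := lin p p0; lia.
have Ll : kappa * L <= f * l.+1.
  rewrite /f -!mulnA leq_mul2l; apply/orP; right.
  by apply: leq_trans Lp _; rewrite leq_mul2l pl orbT.
have apL : (8 * D + 5) * a p <= (8 * D + 5) * C * L.
  rewrite -mulnA leq_mul2l; apply/orP; right; apply: leq_trans (lin p p0) _.
  by rewrite leq_mul2l pL orbT.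
have GL : \sum_(1 <= i < L) a i <= B * D * l + ((8 * D + 5) * D + 1 + f) * (p - l.+1)
    + ((8 * D + 5) * a p + (L - p) + f * (L - p)).
  case: fin => [E|[ltp Lap sm]]; first by rewrite -E; lia.
  rewrite (@big_cat_nat _ _ _ p) //=; apply: leq_add G _.
  rewrite -[X in \sum_(_ <= _ < X) a _](subnKC pL).
  apply: leq_trans (segment_sum sep copy p0 _ _ sm) _; [lia|lia|].
  by rewrite leq_add2l; apply: IH; lia.
apply: leq_trans GL _.
have e1 : B * D * l <= B * D * L by rewrite leq_mul2l; apply/orP; right; lia.
have e2 : ((8 * D + 5) * D + 1) * (p - l.+1) <= ((8 * D + 5) * D + 1) * L.
  by rewrite leq_mul2l; apply/orP; right; lia.
have e3 : f * L = f * (p - l.+1) + f * (L - p) + f * l.+1 by rewrite -!mulnDr; congr (_ * _); lia.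
move: Ll; rewrite e3 /kappa !mulnDl mul1n.
rewrite mulnDl in e2; rewrite mulnDl mul1n in e2.
lia.
Qed.

(** * Distances on the circle *)

Local Open Scope classical_set_scope.
Local Open Scope ring_scope.

Lemma tnorm_le (R : realType) (x : R) (n : int) : tnorm x <= `|x - n%:~R|.
Proof. by apply: ge_inf; [exists 0 => _ [m _ <-]|exists n]. Qed.

Lemma tnorm_attained (R : realType) (x : R) : exists n : int, tnorm x = `|x - n%:~R|.
Proof.
have [f1 f2] : (Num.floor x)%:~R <= x /\ x < (Num.floor x)%:~R + 1.
  by split; [exact: floor_le_tmp|rewrite -intrD1; exact: floorD1_gt].
suff [n nP] : exists n : int, forall m : int, `|x - n%:~R| <= `|x - m%:~R|.
  exists n; apply/eqP; rewrite eq_le tnorm_le /=.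
  by apply: lb_le_inf => [|_ [m _ <-]]; [exists `|x - 0%:~R|, 0|exact: nP].
set m := Num.floor x in f1 f2.
have far (k : int) : k%:~R <= m%:~R :> R \/ m%:~R + 1 <= k%:~R :> R.
  have [km|mk] := leP k m; [by left; rewrite ler_int|right].
  by rewrite -intrD1 ler_int; lia.
have [h|h] := leP (x - m%:~R) (1 / 2).
  exists m => k; rewrite ger0_norm ?subr_ge0 // ler_normr.
  by case: (far k) => ?; apply/orP; [left|right]; lra.
exists (m + 1) => k; rewrite intrD1 ler0_norm; last by lra.
by rewrite ler_normr; case: (far k) => ?; apply/orP; [left|right]; lra.
Qed.

Lemma tnorm_ge0 (R : realType) (x : R) : 0 <= tnorm x.
Proof. by have [n ->] := tnorm_attained x. Qed.

Lemma tnorm_le1 (R : realType) (x : R) : tnorm x <= 1.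
Proof.
apply: le_trans (tnorm_le x (Num.floor x)) _.
have f1 : (Num.floor x)%:~R <= x by exact: floor_le_tmp.
have f2 : x < (Num.floor x)%:~R + 1 by rewrite -intrD1; exact: floorD1_gt.
by rewrite ger0_norm ?subr_ge0 //; lra.
Qed.

Lemma tnorm_le_norm (R : realType) (x : R) : tnorm x <= `|x|.
Proof. by have := tnorm_le x 0; rewrite subr0. Qed.

Lemma tnormDz (R : realType) (x : R) (n : int) : tnorm (x + n%:~R) = tnorm x.
Proof.
apply/eqP; rewrite eq_le; apply/andP; split.
  have [m ->] := tnorm_attained x; apply: le_trans (tnorm_le _ (m + n)) _.
  by rewrite intrD; rewrite le_eqVlt; apply/orP; left; apply/eqP; congr (`|_|); ring.
have [m ->] := tnorm_attained (x + n%:~R); apply: le_trans (tnorm_le _ (m - n)) _.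
by rewrite intrB; rewrite le_eqVlt; apply/orP; left; apply/eqP; congr (`|_|); ring.
Qed.

Lemma tnormN (R : realType) (x : R) : tnorm (- x) = tnorm x.
Proof.
have le (y : R) : tnorm (- y) <= tnorm y.
  have [m ->] := tnorm_attained y; apply: le_trans (tnorm_le _ (- m)) _.
  by rewrite intrN -normrN; rewrite le_eqVlt; apply/orP; left; apply/eqP; congr (`|_|); ring.
by apply/eqP; rewrite eq_le le /= -{1}[x]opprK le.
Qed.

Lemma tnormD (R : realType) (x y : R) : tnorm (x + y) <= tnorm x + tnorm y.
Proof.
have [m ->] := tnorm_attained x; have [n ->] := tnorm_attained y.
apply: le_trans (tnorm_le _ (m + n)) (le_trans _ (ler_normD _ _)).
by rewrite intrD; rewrite le_eqVlt; apply/orP; left; apply/eqP; congr (`|_|); ring.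
Qed.

Lemma tnormB (R : realType) (x y : R) : tnorm (x - y) <= tnorm x + tnorm y.
Proof. by rewrite -(tnormN y) tnormD. Qed.

Lemma tnormMn (R : realType) (k : nat) (x : R) : tnorm (k%:R * x) <= k%:R * tnorm x.
Proof.
have [m ->] := tnorm_attained x; apply: le_trans (tnorm_le _ (k%:Z * m)) _.
by rewrite intrM -pmulrn -mulrBr normrM normr_nat.
Qed.

Lemma norm_le_tnorm (R : realType) (x : R) : `|x| <= 1 / 2 -> `|x| <= tnorm x.
Proof.
move=> x2; have [m ->] := tnorm_attained x.
have [->|m0] := eqVneq m 0; first by rewrite subr0.
have m1 : 1 <= `|m%:~R| :> R by rewrite -intr_norm -[1]/(1%:~R) ler_int; lia.
have := ler_normB x (x - m%:~R); rewrite opprB addrC subrK; lra.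
Qed.

(** * Returns under doubling and the logarithmic averages *)

Lemma iter_doubling (R : realType) (x : R) (i : nat) :
  exists z : int, iter i (@doubling R) x = 2 ^+ i * x + z%:~R.
Proof.
elim: i => [|i [z IH]]; first by exists 0; rewrite /= expr0 mul1r addr0.
rewrite iterS IH /doubling; set f := Num.floor _; exists (2 * z - f).
by rewrite intrB intrM exprS; ring.
Qed.

Lemma tdist_iter_doubling (R : realType) (x : R) (i : nat) :
  tdist (iter i (@doubling R) x) x = tnorm ((2 ^+ i - 1) * x).
Proof.
have [z ->] := iter_doubling x i; rewrite /tdist -(tnormDz ((2 ^+ i - 1) * x) z).
by congr tnorm; ring.
Qed.

(** By 2^d - 1 = (2^(p + d) - 1) - 2^d (2^p - 1), close returns at p and p + d force a close return
    at d, which a linear bound on copy lengths excludes for small d. *)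
Lemma return_dist_separated (R : realType) (x e : R) (p d : nat) :
  tnorm ((2 ^+ p - 1) * x) <= e -> tnorm ((2 ^+ (p + d) - 1) * x) <= e ->
  tnorm ((2 ^+ d - 1) * x) <= 2 ^+ d * e + e.
Proof.
move=> hp hpd.
have -> : (2 ^+ d - 1) * x =
    (2 ^+ (p + d) - 1) * x - (2 ^ d)%:R * ((2 ^+ p - 1) * x).
  by rewrite natrX exprD; ring.
apply: le_trans (tnormB _ _) _; rewrite addrC; apply: lerD => //.
by apply: le_trans (tnormMn _ _) _; rewrite natrX ler_wpM2l.
Qed.

Lemma return_dist_copy (R : realType) (x : R) (p d : nat) :
  tnorm ((2 ^+ d - 1) * x) <=
  tnorm ((2 ^+ (p + d) - 1) * x) + 2 ^+ d * tnorm ((2 ^+ p - 1) * x).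
Proof.
have -> : (2 ^+ d - 1) * x =
    (2 ^+ (p + d) - 1) * x - (2 ^ d)%:R * ((2 ^+ p - 1) * x).
  by rewrite natrX exprD; ring.
apply: le_trans (tnormB _ _) _; rewrite lerD2l.
by apply: le_trans (tnormMn _ _) _; rewrite natrX.
Qed.

(** Closeness of 2^p x and x modulo 1 replaces equality of b digits: carries need no separate
    treatment, at the price of a bounded number of cells per copy. *)
Definition near_copy (R : realType) (B : nat) (x : R) (p b : nat) : Prop :=
  (B <= b)%N /\ tnorm ((2 ^+ p - 1) * x) <= 2 ^- b.

Lemma lt_expr2V (R : realType) (m n : nat) : (2 ^- m < 2 ^- n :> R) = (n < m)%N.
Proof. by rewrite ltf_pV2 ?posrE ?exprn_gt0 // ltr_eXn2l // ltr1n. Qed.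

Lemma le_expr2V (R : realType) (m n : nat) : (2 ^- m <= 2 ^- n :> R) = (n <= m)%N.
Proof. by rewrite leNgt lt_expr2V -leqNgt. Qed.

Lemma expr_unbounded (R : realType) (rho M : R) : 1 < rho -> exists n, M < rho ^+ n.
Proof.
move=> r1; have r0 : 0 < rho - 1 by lra.
exists (Num.truncn (M / (rho - 1))).+1; set n := (Num.truncn _).+1.
have h : M < n%:R * (rho - 1) by rewrite -ltr_pdivrMr // /n truncnS_gt.
apply: (lt_le_trans h); have -> : rho ^+ n = (1 + (rho - 1)) ^+ n by congr (_ ^+ _); ring.
apply: le_trans (_ : 1 + n%:R * (rho - 1) <= _); first by rewrite lerDr.
elim: n {h} => [|n IH]; first by rewrite mul0r addr0 expr0.
rewrite exprS -natr1; have : 0 <= n%:R * (rho - 1) by rewrite mulr_ge0 // ltW.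
by nra.
Qed.

Lemma binary_order (R : realType) (d : R) : 0 <= d <= 1 ->
  exists a, d <= 2 ^- a /\ (0 < d -> 2 ^- a.+1 < d).
Proof.
case/andP=> d0 d1; have [->|dn0] := eqVneq d 0.
  (* Default value at d = 0, where the lower bound is vacuous. *)
  by exists 0%N; rewrite ltxx; split=> //; rewrite invr_ge0 exprn_ge0.
have dp : 0 < d by rewrite lt_neqAle eq_sym dn0.
have ex : exists n, 2 ^- n < d.
  have [n nP] := @expr_unbounded R 2 d^-1 (ltr1n _ 2); exists n.
  by rewrite -[d]invrK ltf_pV2 ?posrE ?invr_gt0 ?exprn_gt0.
case: (ex_minnP ex) => [[|a] aP amin]; first by move: aP; rewrite expr0 invr1; lra.
exists a; split=> // ; rewrite leNgt; apply/negP => /amin; lia.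
Qed.

Lemma avg_log_return_bounded (R : realType) (x : R) (B H N0 : nat) : (0 < B)%N ->
  (forall N l, (N0 <= N)%N -> lz_parse (near_copy B x) 1 N l -> (N <= H * l)%N) ->
  exists M : R, forall k, (M%:E <= avg_log_return x k)%E.
Proof.
move=> B0 incompr; pose delta i := tnorm ((2 ^+ i - 1) * x).
(* A parse by i - 1 literals and one block of length b ends at i + b; incompressibility bounds b
   linearly in i. *)
have reach i b : (0 < i)%N -> (B <= b)%N -> delta i <= 2 ^- b -> (N0 <= i + b)%N ->
    (i + b <= H * i.-1)%N.
  move=> i0 Bb ib Nib; apply: incompr => //; rewrite -[i.-1]addn0.
  apply: (@lz_parse_trans _ 1 i); first by have := lz_parse_lits (near_copy B x) 1 i.-1; rewrite add1n prednK.
  by apply: (@LzCopy _ i b) => //; exact: LzNil.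
(* A vanishing [delta i] would allow blocks of every length at i. Hence no term of the averages is
   -oo. *)
have dpos i : (0 < i)%N -> 0 < delta i.
  move=> i0; rewrite lt_neqAle tnorm_ge0 andbT; apply/negP => /eqP d0.
  have := @reach i (B + N0 + H * i)%N i0; rewrite -d0 invr_ge0 exprn_ge0 // => h.
  have := h _ isT; have : (H * i.-1 <= H * i)%N by rewrite leq_mul2l; lia.
  lia.
have /choice[a aP] : forall i, exists a, delta i <= 2 ^- a /\ (0 < delta i -> 2 ^- a.+1 < delta i).
  by move=> i; apply: binary_order; rewrite tnorm_ge0 tnorm_le1.
have age i m : (0 < i)%N -> delta i <= 2 ^- m -> (m <= a i)%N.
  move=> i0 im; have := lt_le_trans ((aP i).2 (dpos i i0)) im.
  by rewrite lt_expr2V.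
pose C := (H + N0 + B)%N.
have lin p : (0 < p)%N -> (a p <= C * p)%N.
  move=> p0; rewrite /C; case: (ltnP (a p) B) => aB; first by nia.
  case: (ltnP (p + a p)%N N0) => aN; first by nia.
  by have := reach _ _ p0 aB (aP p).1 aN; nia.
have sep p d : (0 < p)%N -> (0 < d)%N -> (minn (a p) (a (p + d)) <= (C + 2) * d)%N.
  move=> p0 d0; set k := minn _ _.
  (* Returns within 2^(- k) at p and p + d give delta d <= (2^d + 1) 2^(- k) <= 2^(- (k - d -
     1)). *)
  suff: (k <= a d + d.+1)%N by have := lin d d0; lia.
  case: (leqP k d.+1) => [|dk]; first by lia.
  rewrite addnC -leq_subLR.
  apply: age => //; have mono i : (k <= a i)%N -> delta i <= 2 ^- k.
    by move=> ki; apply: le_trans (aP i).1 _; rewrite le_expr2V.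
  apply: le_trans (return_dist_separated (mono p (geq_minl _ _)) (mono (p + d)%N (geq_minr _ _))) _.
  have -> : 2 ^- (k - d.+1) = 2 * 2 ^+ d * 2 ^- k :> R.
    by rewrite -{2}(subnK (ltnW dk)) exprD -exprS invfM mulrCA mulfV ?mulr1 //.
  have : 1 <= 2 ^+ d :> R by rewrite exprn_ege1 // ler1n.
  have : 0 < 2 ^- k :> R by rewrite invr_gt0 exprn_gt0.
  by nra.
have copy p d : (0 < p)%N -> (0 < d)%N ->
    (a (p + d) <= (a d).+1)%N \/ (a p <= a (p + d) + d.+1)%N.
  move=> p0 d0; case: (leqP (a p) (a (p + d) + d.+1)) => H2; [by right|left].
  case: (posnP (a (p + d))) => [->//|a0].
  suff : ((a (p + d)).-1 <= a d)%N by lia.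
  apply: age => //; apply: le_trans (return_dist_copy x p d) _.
  apply: le_trans (lerD (aP (p + d)%N).1 (ler_wpM2l _ (aP p).1)) _; first by rewrite exprn_ge0.
  (* When a p > a (p + d) + d + 1, the error carried over from p is no larger than the return at p +
     d, so at most one binary order is lost. *)
  have e1 : 2 ^+ d * 2 ^- a p <= 2 ^- a (p + d) :> R.
    rewrite -ler_pdivlMl ?exprn_gt0 // -invfM -exprD le_expr2V; lia.
  apply: le_trans (lerD (lexx _) e1) _.
  rewrite -{1 2}(prednK a0) exprS invfM; lra.
have [|N l NN par|f fP] := @linear_sum_of_incompressible a B C (C + 2) H N0 B0 _ lin sep copy.
- by lia.
- apply: incompr NN _; apply: sub_lz_parse par => p b /andP[Bb ba]; split=> //.
  by apply: le_trans (aP p).1 _; rewrite le_expr2V.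
(* Each term is at least - (a i + 1), and f (k + 2) <= 2 f (k + 1). *)
exists (- (2 * f%:R + 1)) => k.
have ln2 : 0 < ln 2 :> R by rewrite ln_gt0 // ltr1n.
have term i : (0 < i)%N -> (- ((a i).+1%:R) <= ln (delta i) / ln 2).
  move=> i0; rewrite ler_pdivlMr // mulNr mulr_natl -lnXn // -lnV ?posrE ?exprn_gt0 //.
  by rewrite ler_ln ?posrE ?invr_gt0 ?exprn_gt0 ?dpos // ltW // (aP i).2 // dpos.
rewrite /avg_log_return (_ : \sum_(1 <= i < k.+2) _ = (\sum_(1 <= i < k.+2) (ln (delta i) / ln 2))%:E)%E; last first.
  rewrite -sumEFin big_nat_cond [in RHS]big_nat_cond; apply: eq_bigr => i /andP[/andP[i0 _] _].
  by rewrite tdist_iter_doubling /log2e gt_eqF // dpos.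
rewrite -EFinM lee_fin ler_pdivlMl ?ltr0n // mulrN.
apply: le_trans (_ : \sum_(1 <= i < k.+2) - ((a i).+1%:R) <= _); last first.
  by rewrite big_nat_cond [leRHS]big_nat_cond; apply: ler_sum => i /andP[/andP[i0 _] _]; exact: term.
rewrite sumrN -natr_sum lerN2 -[2]/(2%:R) -natrM natr1 -natrM ler_nat.
rewrite (eq_bigr (fun i => a i + 1)%N) => [|i _]; last by rewrite addn1.
rewrite big_split /= sum_nat_const_nat muln1.
by have := fP k.+2; lia.
Qed.

(** * Counting dyadic cells *)

Definition cell (R : realType) (m : nat) (x : R) : int := Num.floor (2 ^+ m * x).

(** The list may repeat indices and the bound is real, so that bounds add under unions and powers of
    rho can be used directly. *)
Definition meets_few_cells (R : realType) (m : nat) (V : set R) (k : R) : Prop :=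
  exists s : seq int, (size s)%:R <= k /\ forall x, V x -> cell m x \in s.

Lemma meets_few_cells0 (R : realType) (m : nat) : meets_few_cells m (@set0 R) 0.
Proof. by exists [::]. Qed.

Lemma sub_meets_few_cells (R : realType) (m : nat) (V W : set R) (k k' : R) :
  V `<=` W -> k <= k' -> meets_few_cells m W k -> meets_few_cells m V k'.
Proof. by move=> VW kk [s [sk sP]]; exists s; split=> [|x /VW/sP//]; exact: le_trans kk. Qed.

Lemma meets_few_cellsU (R : realType) (m : nat) (V W : set R) (k k' : R) :
  meets_few_cells m V k -> meets_few_cells m W k' -> meets_few_cells m (V `|` W) (k + k').
Proof.
move=> [s [sk sP]] [t [tk tP]]; exists (s ++ t); split.
  by rewrite size_cat natrD lerD.
by move=> x [/sP|/tP]; rewrite mem_cat => ->; rewrite ?orbT.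
Qed.

Lemma meets_few_cells_bigU (R : realType) (m : nat) (I : eqType) (r : seq I)
    (V : I -> set R) (k : I -> R) :
  (forall i, i \in r -> meets_few_cells m (V i) (k i)) ->
  meets_few_cells m [set x | exists2 i, i \in r & V i x] (\sum_(i <- r) k i).
Proof.
elim: r => [|i r IH] h.
  by rewrite big_nil; apply: sub_meets_few_cells (meets_few_cells0 _ _) => // x [].
rewrite big_cons; apply: (@sub_meets_few_cells _ _ _ (V i `|` [set x | exists2 i, i \in r & V i x])
    _ _ _ (lexx _)).
  by move=> x [j]; rewrite inE => /predU1P[->|jr Vx]; [left|right; exists j].
apply: meets_few_cellsU; first by apply: h; rewrite mem_head.
by apply: IH => j jr; apply: h; rewrite inE jr orbT.
Qed.

Lemma cell_bounds (R : realType) (m : nat) (x : R) :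
  (cell m x)%:~R <= 2 ^+ m * x < (cell m x)%:~R + 1.
Proof. by rewrite floor_le_tmp /= -intrD1 floorD1_gt. Qed.

Lemma cellS (R : realType) (m : nat) (x : R) :
  cell m.+1 x = 2 * cell m x \/ cell m.+1 x = 2 * cell m x + 1.
Proof.
have /andP[a1 a2] := cell_bounds m x; have /andP[b1 b2] := cell_bounds m.+1 x.
rewrite exprS in b1 b2; set c := cell m x in a1 a2 *; set d := cell m.+1 x in b1 b2 *.
have h1 : (2 * c)%:~R < (d + 1)%:~R :> R by rewrite intrM intrD1; lra.
have h2 : d%:~R < (2 * c + 2)%:~R :> R by rewrite intrD intrM; lra.
by move: h1 h2; rewrite !ltr_int; lia.
Qed.

(* On a common cell of level p + 2 the number (2^p - 1)(x - y) is its own representative modulo 1,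
   so the two near-copies pin x - y down to scale 2^(- p - b). *)
Lemma near_copy_close (R : realType) (B p b : nat) (x y : R) : (0 < p)%N ->
  cell (p + 2) x = cell (p + 2) y -> near_copy B x p b -> near_copy B y p b ->
  2 ^+ (p + b + 2) * `|x - y| <= 16.
Proof.
move=> p0 xy [_ hx] [_ hy].
have /andP[a1 a2] := cell_bounds (p + 2) x; have /andP[b1 b2] := cell_bounds (p + 2) y.
rewrite xy in a1 a2; rewrite !exprD (_ : 2 ^+ 2 = 4) in a1 a2 b1 b2 *; last by rewrite expr2; ring.
set P := 2 ^+ p in hx hy a1 a2 b1 b2 *; set Q := 2 ^+ b; rewrite -/Q in hx hy.
have P2 : 2 <= P by rewrite /P -(prednK p0) exprS ler_peMr // exprn_ege1 // ler1n.
have Q1 : 1 <= Q by rewrite exprn_ege1 // ler1n.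
have z0 : `|(P - 1) * (x - y)| <= 1 / 2.
  have : `|P * (x - y)| <= 1 / 4 by rewrite ler_norml; apply/andP; split; lra.
  rewrite !normrM (ger0_norm (_ : 0 <= P)) ?(ger0_norm (_ : 0 <= P - 1)); [|lra|lra].
  by have := normr_ge0 (x - y); nra.
have := norm_le_tnorm z0; rewrite mulrBr => h1.
have h2 := le_trans h1 (le_trans (tnormB _ _) (lerD hx hy)).
rewrite -mulrBr normrM (ger0_norm (_ : 0 <= P - 1)) in h2; last by lra.
have Qn : Q^-1 * Q = 1 by rewrite mulVf ?lt0r_neq0 //; lra.
have h3 : (P - 1) * `|x - y| * Q <= 2.
  by apply: le_trans (ler_wpM2r _ h2) _; [lra|rewrite mulrDl Qn; lra].
have : P * (`|x - y| * Q) <= 2 * ((P - 1) * (`|x - y| * Q)).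
  by rewrite mulrA ler_wpM2r ?mulr_ge0 //; lra.
lra.
Qed.

(** All such points lie within 16 cell widths of one reference point x0, so their indices differ
    from that of x0 by at most 16, which leaves 33 values. *)
Lemma near_copy_cells (R : realType) (B p b : nat) (c : int) : (0 < p)%N ->
  exists w : seq int, size w = 33%N /\
    forall x : R, cell (p + 2) x = c -> near_copy B x p b -> cell (p + b + 2) x \in w.
Proof.
move=> p0.
have [[x0 [x0c x0b]]|no] := pselect (exists x0 : R, cell (p + 2) x0 = c /\ near_copy B x0 p b); last first.
  by exists (nseq 33 0); split=> // x xc xb; case: no; exists x.
exists [seq cell (p + b + 2) x0 - 16%:Z + k%:Z | k <- iota 0 33].
split=> [|x xc xb]; first by rewrite size_map size_iota.
have := near_copy_close p0 (etrans xc (esym x0c)) xb x0b.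
have M0 : 0 <= 2 ^+ (p + b + 2) :> R by rewrite exprn_ge0.
rewrite -[X in X * _](ger0_norm M0) -normrM mulrBr ler_norml => /andP[lo hi].
have /andP[a1 a2] := cell_bounds (p + b + 2) x; have /andP[b1 b2] := cell_bounds (p + b + 2) x0.
set u := cell _ x in a1 a2 *; set v := cell _ x0 in b1 b2 *.
have h1 : u%:~R < (v + 17)%:~R :> R by rewrite intrD; lra.
have h2 : v%:~R < (u + 17)%:~R :> R by rewrite intrD; lra.
rewrite !ltr_int in h1 h2.
apply/mapP; exists (absz (u - v + 16%:Z)); last by lia.
by rewrite mem_iota; lia.
Qed.

(** Strong induction through the first step of the parse. A literal leaves 2 cells and one literal
    fewer; a block of length b leaves 33 cells and b positions fewer. The hypothesis on rho is
    exactly what closes this recursion. *)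
Lemma cells_of_lz_parse (R : realType) (rho : R) (B : nat) : (0 < B)%N -> 1 <= rho ->
  (forall n, rho ^+ n + 33 * \sum_(B <= b < n.+2) rho ^+ (n.+1 - b) <= rho ^+ n.+1) ->
  forall n p c l, (0 < p)%N ->
  meets_few_cells (p + n + 2)
    [set x | cell (p + 2) x = c /\
      exists2 l', (l' <= l)%N & lz_parse (near_copy B x) p (p + n) l']
    (2 ^+ l * rho ^+ n).
Proof.
move=> B0 rho1 hrho; have r0 : 0 <= rho by lra.
elim/ltn_ind => -[|n] IH p c l p0.
  exists [:: c]; split=> [|x [<- _]]; last by rewrite addn0 mem_head.
  by rewrite mulr1 exprn_ege1 // ler1n.
pose V p n c l := [set x : R | cell (p + 2) x = c /\
      exists2 l', (l' <= l)%N & lz_parse (near_copy B x) p (p + n) l'].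
have /choice[w wP] b := @near_copy_cells R B p b c p0.
pose Vlit := [set x | exists2 c', c' \in [:: 2 * c; 2 * c + 1] & V p.+1 n c' l.-1 x /\ (0 < l)%N].
pose Vcopy := [set x | exists2 b, b \in index_iota B n.+2 &
  exists2 c', c' \in w b & V (p + b)%N (n.+1 - b)%N c' l x].
apply: (@sub_meets_few_cells _ _ _ (Vlit `|` Vcopy) (2 ^+ l * rho ^+ n +
    \sum_(b <- index_iota B n.+2) \sum_(c' <- w b) 2 ^+ l * rho ^+ (n.+1 - b))).
- move=> x [xc [l' l'l /lz_parse_inv[|[l1 l'E par]|[b cb par]]]]; first by lia.
  + left; have := cellS (p + 2) x; rewrite xc => h.
    exists (cell (p.+1 + 2) x); first by rewrite !inE addSn; case: h => ->; rewrite eqxx ?orbT.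
    split; last by lia.
    by split=> //; exists l1; [lia|rewrite addSnnS].
  + right; have pbq := lz_parse_le par; have [Bb _] := cb.
    exists b; first by rewrite mem_index_iota Bb /=; lia.
    exists (cell (p + b + 2) x); first exact: (wP b).2.
    split=> //; exists l' => //; rewrite (_ : (p + b + _ = p + n.+1)%N) //; lia.
- have -> : \sum_(b <- index_iota B n.+2) \sum_(c' <- w b) 2 ^+ l * rho ^+ (n.+1 - b) =
      2 ^+ l * (33 * \sum_(B <= b < n.+2) rho ^+ (n.+1 - b)).
    rewrite !mulr_sumr; apply: eq_bigr => b _.
    rewrite big_const_seq count_predT (wP b).1 -Monoid.iteropE /=.
    by ring.
  by rewrite -mulrDr ler_wpM2l ?exprn_ge0.
apply: meets_few_cellsU.
  case: (posnP l) => [l0|l0].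
    apply: sub_meets_few_cells (meets_few_cells0 _ _); first by move=> x [c' _ []]; rewrite l0.
    by rewrite mulr_ge0 ?exprn_ge0.
  have -> : 2 ^+ l * rho ^+ n = \sum_(c' <- [:: 2 * c; 2 * c + 1]) 2 ^+ l.-1 * rho ^+ n.
    by rewrite !big_cons big_nil -{1}(prednK l0) exprS; ring.
  apply: meets_few_cells_bigU => c' _.
  rewrite -(addSnnS p n); apply: sub_meets_few_cells _ (lexx _) (IH n (ltnSn n) p.+1 c' l.-1 isT) => x [Vx _]; exact: Vx.
apply: meets_few_cells_bigU => b; rewrite mem_index_iota => /andP[Bb bn].
apply: meets_few_cells_bigU => c' _.
have -> : (p + n.+1 = p + b + (n.+1 - b))%N by lia.
by apply: IH; lia.
Qed.

(** * Hausdorff measure of limsup sets *)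

Lemma tdiam_ge0 (R : realType) (U : set R) : 0 <= tdiam U.
Proof.
have [->|/set0P[u Uu]] := eqVneq U set0.
  rewrite /tdiam (_ : [set tdist u v | u in set0 & v in set0] = set0) ?sup0 //.
  by apply/seteqP; split=> // z [].
apply: le_trans (tnorm_ge0 (u - u)) _; apply: ub_le_sup; last by exists u => //; exists u.
by exists 1 => _ [v _ [w _ <-]]; exact: tnorm_le1.
Qed.

Lemma tdiam_le (R : realType) (U : set R) (r : R) : 0 <= r ->
  (forall u v, U u -> U v -> `|u - v| <= r) -> tdiam U <= r.
Proof.
move=> r0 Ur; have [->|/set0P[u Uu]] := eqVneq U set0.
  rewrite /tdiam (_ : [set tdist u v | u in set0 & v in set0] = set0) ?sup0 //.
  by apply/seteqP; split=> // z [].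
apply: ge_sup; first by exists (tdist u u), u => //; exists u.
by move=> _ [v Uv [w Uw <-]]; apply: le_trans (tnorm_le_norm _) _; exact: Ur.
Qed.

Lemma diam_pow_ge0 (R : realType) (s : R) (U : set R) : 0 <= diam_pow s U.
Proof. by rewrite /diam_pow; case: ifP => // _; exact: powR_ge0. Qed.

Lemma cell_close (R : realType) (m : nat) (x y : R) :
  cell m x = cell m y -> `|x - y| <= 2 ^- m.
Proof.
move=> E; have /andP[a1 a2] := cell_bounds m x; have /andP[b1 b2] := cell_bounds m y.
rewrite E in a1 a2; have M0 : 0 < 2 ^+ m :> R by rewrite exprn_gt0.
rewrite -[2 ^- m]mul1r ler_pdivlMr // mulrC -{1}(gtr0_norm M0) -normrM ler_norml.
by apply/andP; split; lra.
Qed.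

Lemma tdiam_cell (R : realType) (m : nat) (c : int) :
  tdiam [set x : R | torus x /\ cell m x = c] <= 2 ^- m.
Proof.
apply: tdiam_le => [|u v [_ uc] [_ vc]]; first by rewrite invr_ge0 exprn_ge0.
by apply: cell_close; rewrite uc.
Qed.

Lemma expr2V_powR (R : realType) (s : R) (m : nat) : (2 ^- m) `^ s = (2^-1 `^ s) ^+ m.
Proof.
rewrite -exprVn -powR_mulrn ?invr_ge0 // -powR_mulrn ?powR_ge0 //.
by rewrite -!powRrM mulrC.
Qed.

Lemma hausdorff_delta_ge0 (R : realType) (s delta : R) (A : set R) :
  (0 <= hausdorff_delta s delta A)%E.
Proof.
apply: le_ereal_inf_tmp => _ [U _ <-].
by apply: nneseries_ge0 => i _ _; rewrite lee_fin diam_pow_ge0.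
Qed.

Lemma hausdorff_measure_eq0 (R : realType) (s : R) (A : set R) :
  (forall delta e, 0 < delta -> 0 < e -> exists U : nat -> set R,
    [/\ forall i, U i `<=` @torus R, A `<=` \bigcup_i U i,
        forall i, tdiam (U i) <= delta &
        forall n, \sum_(0 <= i < n) diam_pow s (U i) <= e]) ->
  hausdorff_measure s A = 0%E.
Proof.
move=> h; apply/eqP; rewrite eq_le; apply/andP; split.
  apply: ge_ereal_sup => _ [delta delta0 <-]; apply/lee_addgt0Pr => e e0; rewrite add0e.
  have [U [Ut AU Ud Us]] := h _ _ delta0 e0.
  apply: le_trans (ereal_inf_lbound _) _; first by exists U => //; split.
  apply: lime_le.
    by apply: is_cvg_nneseries => i _ _; rewrite lee_fin diam_pow_ge0.
  by apply: nearW => n; rewrite sumEFin lee_fin.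
apply: le_trans (hausdorff_delta_ge0 s 1 A) _.
by apply: ereal_sup_ubound; exists 1 => //=; rewrite ltr01.
Qed.

(** The block of positions from 2^m to 2^(m + 1) - 1 meets each index of level m once, so
    repetitions in t do no harm. *)
Lemma count_cells_le (m : nat) (t : seq int) :
  (\sum_(2 ^ m <= e < 2 ^ m.+1) ((e - 2 ^ m)%N%:Z \in t) <= size t)%N.
Proof.
rewrite -[X in (\sum_(X <= _ < _) _ <= _)%N]add0n big_addn expnS mul2n -addnn addnK.
rewrite (eq_bigr (fun i : nat => ((i%:Z \in t) : nat))) => [|i _]; last by rewrite addnK.
rewrite -big_mkcond /= sum1_count -size_filter -(size_map Posz).
apply: uniq_leq_size; last by move=> _ /mapP[i + ->]; rewrite mem_filter => /andP[].
by rewrite map_inj_uniq ?filter_uniq ?iota_uniq // => i j [].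
Qed.

(* The cell of level m and index j < 2 ^ m is stored at position 2 ^ m + j. *)
Definition selected_cell (R : realType) (t : nat -> seq int) (m0 e : nat) : set R :=
  let m := trunc_log 2 e in
  let c : int := (e - 2 ^ m)%N in
  if (m0 <= m)%N && (c \in t m) then [set x | torus x /\ cell m x = c] else set0.

Lemma diam_pow_selected_cell (R : realType) (s : R) t m0 m e : 0 < s ->
  (2 ^ m <= e < 2 ^ m.+1)%N ->
  diam_pow s (@selected_cell R t m0 e) <=
  ((m0 <= m)%N && ((e - 2 ^ m)%N%:Z \in t m))%:R * (2^-1 `^ s) ^+ m.
Proof.
move=> s0 /trunc_log_eq E; rewrite /selected_cell E //.
case: ifP => _; last by rewrite /diam_pow eqxx mul0r.
rewrite mul1r /diam_pow; case: ifP => _; first by rewrite exprn_ge0 ?powR_ge0.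
rewrite -expr2V_powR; apply: ge0_ler_powR; rewrite ?nnegrE ?tdiam_ge0 ?invr_ge0 ?exprn_ge0 //.
  exact: ltW.
exact: tdiam_cell.
Qed.

Lemma sum_selected_cells (R : realType) (s c tau : R) t (m0 k : nat) : 0 < s -> (0 < m0)%N ->
  (forall m, (size (t m))%:R <= c * tau ^+ m) -> tau * 2^-1 `^ s < 1 ->
  \sum_(0 <= e < 2 ^ (m0 + k)) diam_pow s (@selected_cell R t m0 e) <=
  c * ((tau * 2^-1 `^ s) ^+ m0 - (tau * 2^-1 `^ s) ^+ (m0 + k)) / (1 - tau * 2^-1 `^ s).
Proof.
move=> s0 m00 tP; set q := tau * _ => q1; elim: k => [|k IH].
  rewrite addn0 subrr mulr0 mul0r big_nat_cond big1 // => e /andP[/andP[_ em] _].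
  rewrite /selected_cell ifF /diam_pow ?eqxx //; apply/negbTE; rewrite negb_and -ltnNge.
  (* Position 0 belongs to no level; its logarithm defaults to 0, which is below m0. *)
  apply/orP; left; case: e em => [|e] em; first by rewrite trunc_log0.
  rewrite -(@ltn_exp2l 2) //; apply: leq_ltn_trans em.
  by have /andP[] := @trunc_log_bounds 2 e.+1 isT isT.
rewrite (@big_cat_nat _ _ _ (2 ^ (m0 + k))%N) //=; last by rewrite leq_exp2l // addnS.
set m := (m0 + k)%N in IH *; rewrite addnS -/m.
have blk : \sum_(2 ^ m <= e < 2 ^ m.+1) diam_pow s (@selected_cell R t m0 e) <= c * q ^+ m.
  apply: le_trans (_ : (size (t m))%:R * (2^-1 `^ s) ^+ m <= _); last first.
    rewrite /q exprMn mulrA; apply: ler_wpM2r (tP m); by rewrite exprn_ge0 ?powR_ge0.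
  apply: le_trans (_ : \sum_(2 ^ m <= e < 2 ^ m.+1) ((e - 2 ^ m)%N%:Z \in t m)%:R *
      (2^-1 `^ s) ^+ m <= _).
    rewrite big_nat_cond [leRHS]big_nat_cond; apply: ler_sum => e /andP[em _].
    apply: le_trans (@diam_pow_selected_cell R s t m0 m e s0 em) _.
    by rewrite (_ : (m0 <= m)%N) // leq_addr.
  rewrite -mulr_suml -natr_sum; apply: ler_wpM2r; first by rewrite exprn_ge0 ?powR_ge0.
  by rewrite ler_nat count_cells_le.
apply: le_trans (lerD IH blk) _; rewrite le_eqVlt; apply/orP; left; apply/eqP.
rewrite exprS; field; lra.
Qed.

(** Covering argument of Borel-Cantelli type: the selected cells of all levels m >= m0 cover A, and
    their s-sum is at most the geometric tail c q^m0 / (1 - q) with q = tau 2^(- s). *)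
Lemma hausdorff_measure_limsup_eq0 (R : realType) (s c tau : R) (A : set R) (E : nat -> set R) :
  0 < s -> 0 < tau -> tau * 2^-1 `^ s < 1 ->
  (forall m, meets_few_cells m (E m) (c * tau ^+ m)) ->
  A `<=` @torus R -> (forall m0 x, A x -> exists2 m, (m0 <= m)%N & E m x) ->
  hausdorff_measure s A = 0%E.
Proof.
move=> s0 tau0; set q := tau * _ => q1 /choice[t tP] At AE.
apply: hausdorff_measure_eq0 => delta e delta0 e0.
have q0 : 0 < q by rewrite mulr_gt0 // powR_gt0.
have c0 : 0 <= c by have := le_trans (ler0n R _) (tP 0%N).1; rewrite expr0 mulr1.
have [n1 n1P] := @expr_unbounded R 2 delta^-1 (ltr1n _ 2).
have [|n2 n2P] := @expr_unbounded R q^-1 (c / (1 - q) / e); first by rewrite invf_gt1.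
(* n1 makes the diameters at most delta, n2 makes the tail at most e, and the successor keeps m0
   positive. *)
pose m0 := (n1 + n2).+1.
exists (@selected_cell R t m0); split.
- by move=> i x; rewrite /selected_cell; case: ifP => // _ [].
- move=> x Ax; have [m m0m Ex] := AE m0 x Ax.
  have /andP[x0 x1] := At x Ax; have /andP[a1 a2] := cell_bounds m x.
  have M0 : 0 < 2 ^+ m :> R by rewrite exprn_gt0.
  have lo : 0 <= cell m x by rewrite floor_ge0 mulr_ge0 // ltW.
  have hi : cell m x < (2 ^ m)%N.
    rewrite -(ltr_int R) -pmulrn natrX; apply: le_lt_trans a1 _.
    by rewrite gtr_pMr.
  exists (2 ^ m + absz (cell m x))%N => //; rewrite /selected_cell.
  rewrite (@trunc_log_eq 2 m) //; last by rewrite expnS; lia.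
  by rewrite addKn gez0_abs // m0m (tP m).2 //=; split=> //; exact: At.
- move=> i; rewrite /selected_cell; case: ifP => [/andP[m0i _]|_]; last first.
    by apply: tdiam_le => //; exact: ltW.
  apply: le_trans (tdiam_cell _ _ _) _.
  rewrite -[delta]invrK lef_pV2 ?posrE ?invr_gt0 ?exprn_gt0 //.
  apply: le_trans (ltW n1P) _; rewrite ler_weXn2l // ?ler1n //.
  by apply: leq_trans m0i; rewrite /m0; lia.
- move=> n; apply: le_trans (_ : \sum_(0 <= i < 2 ^ (m0 + n)) diam_pow s (@selected_cell R t m0 i) <= _).
    rewrite [leRHS](@big_cat_nat _ _ _ n) //=; last first.
      by apply: leq_trans (ltnW (ltn_expl n (isT : 1 < 2)%N)) _; rewrite leq_exp2l // leq_addl.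
    by rewrite lerDl sumr_ge0 // => i _; exact: diam_pow_ge0.
  have := @sum_selected_cells R s c tau t m0 n s0 isT (fun m => (tP m).1) q1.
  move=> h; apply: le_trans h _; rewrite -/q.
  have qm0 : q ^+ m0 <= q ^+ n2 by rewrite ler_wiXn2l ?ltW // /m0; lia.
  have qn : 0 <= q ^+ (m0 + n) by rewrite exprn_ge0 // ltW.
  have d0 : 0 <= c / (1 - q) by rewrite divr_ge0 // subr_ge0 ltW.
  rewrite mulrAC; apply: le_trans (_ : c / (1 - q) * q ^+ n2 <= _).
    by apply: ler_wpM2l => //; lra.
  by move: n2P; rewrite exprVn ltr_pdivrMr // ltr_pdivlMl ?exprn_gt0 // mulrC => /ltW.
Qed.

(** * Choice of parameters and the dimension of [X_infty] *)

Lemma geometric_block_bound (R : realType) (rho : R) : 1 < rho ->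
  exists2 B, (0 < B)%N & forall n,
    rho ^+ n + 33 * \sum_(B <= b < n.+2) rho ^+ (n.+1 - b) <= rho ^+ n.+1.
Proof.
move=> r1; have r0 : 0 < rho - 1 by lra.
(* After division by rho^n the full tail over b >= B is 33 rho^(2 - B) / (rho - 1), and it has to be
   at most rho - 1. *)
have [B0 B0P] := expr_unbounded (33 * rho ^+ 2 / (rho - 1) ^+ 2) r1.
have BP : 33 * rho ^+ 2 <= rho ^+ B0.+1 * (rho - 1) ^+ 2.
  rewrite -ler_pdivrMr ?exprn_gt0 //; apply: le_trans (ltW B0P) _.
  by rewrite ler_weXn2l // ltW.
exists B0.+1 => // n; set B := B0.+1 in BP *.
have [nB|Bn] := leqP n.+2 B.
  by rewrite big_geq // mulr0 addr0 ler_weXn2l // ltW.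
have -> : \sum_(B <= b < n.+2) rho ^+ (n.+1 - b) = \sum_(0 <= i < n.+2 - B) rho ^+ i.
  rewrite big_nat_rev /= -{1}[B]add0n big_addn big_nat_cond [RHS]big_nat_cond.
  by apply: eq_bigr => i ib; congr (_ ^+ _); lia.
set S := \sum_(_ <= _ < _) _; set k := (n.+2 - B)%N in S *.
have SE : (rho - 1) * S = rho ^+ k - 1 by rewrite /S big_mkord subrX1.
have rk : rho ^+ n.+2 = rho ^+ k * rho ^+ B by rewrite -exprD /k subnK // ltnW.
have rB : 0 < rho ^+ B by rewrite exprn_gt0 //; lra.
have rn : 0 < rho ^+ n by rewrite exprn_gt0 //; lra.
rewrite exprS; suff : 33 * ((rho - 1) * S) <= (rho - 1) ^+ 2 * rho ^+ n.
  rewrite expr2 -mulrA mulrCA -subr_ge0 -mulrBr pmulr_rge0 // => h; lra.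
rewrite SE; apply: le_trans (_ : 33 * rho ^+ k <= _); first lra.
rewrite -(ler_pM2r rB) -[33 * _ * _]mulrA -rk.
have -> : rho ^+ n.+2 = rho ^+ n * rho ^+ 2 by rewrite -exprD addn2.
by have := ler_wpM2l (ltW rn) BP; lra.
Qed.

(* The cells of level m = N + 2 refine position N by two digits, the margin needed to read off
   the next copy. *)
Definition compressible_at (R : realType) (B H m : nat) : set R :=
  [set x | torus x /\ exists N l,
    [/\ m = N.+2, lz_parse (near_copy B x) 1 N l & (H * l < N)%N]].

(** Parsing starts at position 1, in one of the 8 cells of level 3, with n = m - 3 positions to go
    and at most l = floor(n / H) literals; then 2^l <= rho^(H l) <= rho^n. *)
Lemma compressible_few_cells (R : realType) (rho : R) (B H : nat) : (0 < B)%N -> 1 < rho ->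
  (forall n, rho ^+ n + 33 * \sum_(B <= b < n.+2) rho ^+ (n.+1 - b) <= rho ^+ n.+1) ->
  (0 < H)%N -> 2 <= rho ^+ H ->
  forall m, meets_few_cells m (compressible_at B H m) (8 * (rho ^+ 2) ^+ m).
Proof.
move=> B0 r1 hrho H0 rH m; have r0 : 0 <= rho by lra.
have [m3|m3] := ltnP m 3.
  apply: sub_meets_few_cells (meets_few_cells0 R m).
    by move=> x [_ [N [l [mN /lz_parse_le]]]]; lia.
  by rewrite mulr_ge0 ?exprn_ge0.
have -> : m = (1 + (m - 3) + 2)%N by lia.
set n := (m - 3)%N; set l := (n %/ H)%N.
pose V c := [set x : R | cell (1 + 2) x = c /\
      exists2 l', (l' <= l)%N & lz_parse (near_copy B x) 1 (1 + n) l'].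
apply: (@sub_meets_few_cells _ _ _ [set x | exists2 c, c \in [seq i%:Z | i <- iota 0 8] & V c x]
   (\sum_(c <- [seq i%:Z | i <- iota 0 8]) 2 ^+ l * rho ^+ n)).
- move=> x [/andP[x0 x1] [N [l' [mN par Hl]]]].
  have /andP[a1 a2] := cell_bounds (1 + 2) x.
  have e8 : 2 ^+ (1 + 2) = 8 :> R by rewrite !exprS expr0; ring.
  rewrite e8 in a1 a2.
  have lo : (-1)%:~R < (cell (1 + 2) x)%:~R :> R by rewrite intrN; lra.
  have hi : (cell (1 + 2) x)%:~R < 8%:~R :> R by lra.
  rewrite !ltr_int in lo hi.
  exists (cell (1 + 2) x).
    apply/mapP; exists (absz (cell (1 + 2) x)); last by lia.
    by rewrite mem_iota; lia.
  split=> //; exists l'; last by rewrite (_ : (1 + n)%N = N) //; lia.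
  by rewrite /l leq_divRL //; lia.
- rewrite big_map (_ : \sum_(i <- iota 0 8) _ = 8 * (2 ^+ l * rho ^+ n)); last first.
    by rewrite /= !big_cons big_nil; ring.
  apply: ler_wpM2l => //.
  have h2 : 2 ^+ l <= rho ^+ n.
    apply: le_trans (_ : (rho ^+ H) ^+ l <= _); first by apply: lerXn2r; rewrite ?nnegrE ?exprn_ge0.
    by rewrite -exprM ler_weXn2l ?ltW // mulnC leq_trunc_div.
  apply: le_trans (ler_wpM2r _ h2) _; first by rewrite exprn_ge0.
  by rewrite -exprD -exprM ler_weXn2l ?ltW //; lia.
by apply: meets_few_cells_bigU => c _; exact: (cells_of_lz_parse B0 (ltW r1) hrho).
Qed.

Lemma limn_einf_ge (R : realType) (u : (\bar R)^nat) (M : \bar R) :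
  (forall n, M <= u n)%E -> (M <= limn_einf u)%E.
Proof.
move=> Mu; rewrite limn_einf_lim; apply: lime_ge; first exact: is_cvg_einfs.
by apply: nearW => n; apply: le_ereal_inf_tmp => _ [m _ <-].
Qed.

(** Otherwise every parse up to N >= m0 needs at least N / H literals, and the averages are bounded
    below. *)
Lemma X_infty_compressible (R : realType) (B H m0 : nat) (x : R) : (0 < B)%N ->
  X_infty x -> exists2 m, (m0 <= m)%N & compressible_at B H m x.
Proof.
move=> B0 [xt xinf]; apply: contrapT => no.
have [|M MP] := @avg_log_return_bounded R x B H m0 B0.
  move=> N l mN par; rewrite leqNgt; apply/negP => Hl; apply: no.
  by exists N.+2; [lia|split=> //; exists N, l].
by have := limn_einf_ge MP; rewrite xinf.
Qed.

Lemma hausdorff_measure_X_infty (R : realType) (s : R) : 0 < s ->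
  hausdorff_measure s (@X_infty R) = 0%E.
Proof.
move=> s0; set kappa := 2^-1 `^ s : R.
have k0 : 0 < kappa by rewrite powR_gt0.
have k1 : kappa < 1.
  rewrite /kappa /powR invr_eq0 pnatr_eq0 /= expR_lt1 pmulr_rlt0 // lnV ?posrE // oppr_lt0.
  by rewrite ln_gt0 // ltr1n.
(* With rho = kappa^(- 1 / 4) the growth rate is tau = rho^2 = kappa^(- 1 / 2), so tau kappa =
   kappa^(1 / 2) < 1. *)
pose sigma := Num.sqrt kappa^-1; pose rho := Num.sqrt sigma.
have sq : sigma ^+ 2 = kappa^-1 by rewrite sqr_sqrtr // invr_ge0 ltW.
have s1 : 1 < sigma by rewrite -sqrtr1 ltr_sqrt ?invf_gt1 // invr_gt0.
have rq : rho ^+ 2 = sigma by rewrite sqr_sqrtr //; lra.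
have r1 : 1 < rho by rewrite -sqrtr1 ltr_sqrt //; lra.
have [B B0 BP] := geometric_block_bound r1.
have [H0 H0P] := expr_unbounded 2 r1.
apply: (@hausdorff_measure_limsup_eq0 R s 8 (rho ^+ 2) _ (@compressible_at R B H0.+1)) => //.
- by rewrite rq; lra.
- rewrite rq -/kappa -[kappa]invrK -sq expr2 invfM mulrA mulfV ?mul1r ?invf_lt1 //; lra.
- apply: compressible_few_cells => //; apply: le_trans (ltW H0P) _.
  by rewrite ler_weXn2l ?ltW.
- by move=> x [].
- by move=> m0 x; exact: X_infty_compressible.
Qed.

Theorem theorem4p1 (R : realType) : hausdorff_dim (@X_infty R) = 0%E.
Proof.
apply/eqP; rewrite eq_le; apply/andP; split.
  apply/lee_addgt0Pr => e e0; rewrite add0e; apply: ereal_inf_lbound.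
  by exists e => //; split; [exact: ltW|exact: hausdorff_measure_X_infty].
by apply: le_ereal_inf_tmp => _ [s [s0 _] <-]; rewrite lee_fin.
Qed.
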